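(* Let $\mathbb{F}=\mathbb{F}_{FSD}$, let $x_0>0$, and assume conditions (C3) and (C4) hold with least favorable measure $\mathbb{P}^*$. Let $(W_{\mathbb{P}})_{\mathbb{P}\in\mathcal{P}}$ be a law invariant family of preferences that is $\mathbb{F}_{FSD}$-family consistent on $\mathcal{Y}^{x_0}_{(W_{\mathbb{P}})_{\mathbb{P}\in\mathcal{P}}}$ with respect to $\mathbb{P}^*$. Assume that the maximization problem $\max_{X\in\mathcal{Y}^{x_0}_{W_{\mathbb{P}^*}}}W_{\mathbb{P}^*}(X)$ has a solution $\tilde X\in\mathcal{Y}^{x_0}_{(W_{\mathbb{P}})_{\mathbb{P}\in\mathcal{P}}}$. Then the maximum in the robust problem is attained and $$\max_{X\in\mathcal{Y}^{x_0}_{(W_{\mathbb{P}})_{\mathbb{P}\in\mathcal{P}}}}\ \inf_{\mathbb{P}\in\mathcal{P}}W_{\mathbb{P}}(X)=\max_{X\in\mathcal{Y}^{x_0}_{W_{\mathbb{P}^*}}}W_{\mathbb{P}^*}(X).$$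
   Context: Standing setting: fix $T>0$, $r\in\mathbb{R}$, $S_0>0$, and write $\mathbb{R}_+=[0,\infty)$. Let $S_T:\Omega\to\mathbb{R}_+$ be a random variable and $\mathcal{F}=\sigma(S_T)$. $\mathcal{P}$ is a set of mutually equivalent probability measures on $(\Omega,\mathcal{F})$, and $\mathbb{Q}$ is a probability measure on $(\Omega,\mathcal{F})$ equivalent to every $\mathbb{P}\in\mathcal{P}$. The set of payoffs is $\mathcal{X}=\{g(S_T): g:\mathbb{R}_+\to\mathbb{R}_+\text{ measurable}, E_{\mathbb{Q}}[|g(S_T)|]<\infty\}$, with price $e^{-rT}E_{\mathbb{Q}}[X]$. For $\mathbb{P}\in\mathcal{P}$, $\ell^{\mathbb{P}}=d\mathbb{P}/d\mathbb{Q}$; $F_X^{\mathbb{P}}$ is the cdf of $X$ under $\mathbb{P}$. For a set $\mathbb{F}$ of measurable functions $\mathbb{R}_+\to\mathbb{R}$ and cdfs $F,G$ on $\mathbb{R}_+$, $F\preceq_{\mathbb{F}}G$ means $\int f\,dF\le\int f\,dG$ for all $f\in\mathbb{F}$ with finite integrals. $\mathbb{F}_{FSD}$ is the set of all non-decreasing functions $\mathbb{R}_+\to\mathbb{R}$. Least favorable measure: $\mathbb{P}^*\in\mathcal{P}$ with $\ell^*=d\mathbb{P}^*/d\mathbb{Q}$ such that $F_{\ell^*}^{\mathbb{P}^*}\preceq_{\mathbb{F}}F_{\ell^*}^{\mathbb{P}}$ for all $\mathbb{P}\in\mathcal{P}$. (C3): $\mathcal{P}$ contains a least favorable measure $\mathbb{P}^*$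 w.r.t. $\mathbb{F}$. (C4): $x\mapsto F^{\mathbb{P}^*}_{\ell^*}(x)$ is continuous and $1/\ell^*$ has finite variance under $\mathbb{P}^*$. Preferences: a preference is a functional $W:\mathcal{X}\to\mathbb{R}$. $W_{\mathbb{P}}$ is $\mathbb{P}$-law invariant if $F_X^{\mathbb{P}}=F_Y^{\mathbb{P}}$ implies $W_{\mathbb{P}}(X)=W_{\mathbb{P}}(Y)$; the family $(W_{\mathbb{P}})_{\mathbb{P}\in\mathcal{P}}$ is law invariant if each $W_{\mathbb{P}}$ is $\mathbb{P}$-law invariant. For $\mathcal{Y}\subset\mathcal{X}$, the family is $\mathbb{F}$-family consistent on $\mathcal{Y}$ with respect to $\mathbb{P}^*\in\mathcal{P}$ if for every $Y\in\mathcal{Y}$: $F_Y^{\mathbb{P}^*}\preceq_{\mathbb{F}}F_Y^{\mathbb{P}}$ for all $\mathbb{P}\in\mathcal{P}$ implies $W_{\mathbb{P}^*}(Y)\le W_{\mathbb{P}}(Y)$ for all $\mathbb{P}\in\mathcal{P}$. Feasible sets: for $x_0>0$, $\mathcal{Y}^{x_0}_{W_{\mathbb{P}}}=\{X\in\mathcal{X}: W_{\mathbb{P}}(X)\in\mathbb{R},\ e^{-rT}E_{\mathbb{Q}}[X]\le x_0\}$ and $\mathcal{Y}^{x_0}_{(W_{\mathbb{P}})_{\mathbb{P}\in\mathcal{P}}}=\bigcap_{\mathbb{P}\in\mathcal{P}}\mathcal{Y}^{x_0}_{W_{\mathbb{P}}}$. *)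

(* Defs.v *)
From HB Require Import structures.
From mathcomp Require Import all_boot all_order all_algebra.
From mathcomp Require Import all_classical all_reals all_analysis.
Set Implicit Arguments. Unset Strict Implicit. Unset Printing Implicit Defensive.
Import Order.TTheory GRing.Theory Num.Theory.
Import numFieldNormedType.Exports.
Local Open Scope classical_set_scope.
Local Open Scope ring_scope.

Section defs.
Context (R : realType) (d : measure_display) (Om : measurableType d).
Local Open Scope ereal_scope.

Definition generated_by (S : Om -> R) : Prop :=
  forall A : set Om, measurable A <-> exists B : set R, measurable B /\ A = S @^-1` B.

Definition equiv_meas (P P' : probability Om R) : Prop := P `<< P' /\ P' `<< P.

Definition is_RN_density (P Q : probability Om R) (l : Om -> R) : Prop :=
  [/\ measurable_fun setT l, (forall w, (0 <= l w)%R) &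
      forall A, measurable A -> P A = \int[Q]_(w in A) (l w)%:E].

Definition cdfP (P : probability Om R) (X : Om -> R) (x : R) : \bar R :=
  P [set w | (X w <= x)%R].

Definition law (P : probability Om R) (X : Om -> R) : set R -> \bar R :=
  pushforward P X.

Definition fsd_le (mu nu : set R -> \bar R) : Prop :=
  forall f : R -> R,
    (forall x y : R, (0 <= x)%R -> (x <= y)%R -> (f x <= f y)%R) ->
    mu.-integrable [set x : R | (0 <= x)%R] (EFin \o f) ->
    nu.-integrable [set x : R | (0 <= x)%R] (EFin \o f) ->
    \int[mu]_(x in [set x : R | (0 <= x)%R]) (f x)%:E
      <= \int[nu]_(x in [set x : R | (0 <= x)%R]) (f x)%:E.

Definition payoff (Q : probability Om R) (S : Om -> R) (X : Om -> R) : Prop :=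
  (exists g : R -> R, [/\ measurable_fun [set x : R | (0 <= x)%R] g,
       (forall x, (0 <= x)%R -> (0 <= g x)%R) & X = g \o S])
  /\ Q.-integrable setT (EFin \o X).

Definition price (Q : probability Om R) (r Tm : R) (X : Om -> R) : \bar R :=
  (expR (- (r * Tm)))%:E * \int[Q]_w (X w)%:E.

(* Y^{x0}_{W_P}; preferences are real-valued, so "W_P(X) \in R" is automatic *)
Definition Ysingle (Q : probability Om R) (S : Om -> R) (r Tm x0 : R)
  (WP : (Om -> R) -> R) : set (Om -> R) :=
  [set X | payoff Q S X /\ price Q r Tm X <= x0%:E].

Definition Yfam (Pset : set (probability Om R)) (Q : probability Om R)
  (S : Om -> R) (r Tm x0 : R) (W : probability Om R -> (Om -> R) -> R)
  : set (Om -> R) :=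
  [set X | forall P, Pset P -> Ysingle Q S r Tm x0 (W P) X].

Definition least_favorable (Pset : set (probability Om R)) (Q : probability Om R)
  (Pstar : probability Om R) (lstar : Om -> R) : Prop :=
  [/\ Pset Pstar, is_RN_density Pstar Q lstar &
      forall P, Pset P -> fsd_le (law Pstar lstar) (law P lstar)].

Definition condC4 (Pstar : probability Om R) (lstar : Om -> R) : Prop :=
  continuous (fun x : R => fine (cdfP Pstar lstar x)) /\
  (fun w => (lstar w)^-1)%R \in Lfun Pstar 2%:E.

Definition law_invariant_family (Pset : set (probability Om R))
  (Q : probability Om R) (S : Om -> R) (W : probability Om R -> (Om -> R) -> R)
  : Prop :=
  forall P, Pset P -> forall X Y, payoff Q S X -> payoff Q S Y ->
    (forall x, cdfP P X x = cdfP P Y x) -> W P X = W P Y.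

Definition fsd_family_consistent (Pset : set (probability Om R))
  (W : probability Om R -> (Om -> R) -> R) (Y : set (Om -> R))
  (Pstar : probability Om R) : Prop :=
  forall Y0, Y Y0 ->
    (forall P, Pset P -> fsd_le (law Pstar Y0) (law P Y0)) ->
    forall P, Pset P -> (W Pstar Y0 <= W P Y0)%R.

Definition robust_value (Pset : set (probability Om R))
  (W : probability Om R -> (Om -> R) -> R) (X : Om -> R) : \bar R :=
  ereal_inf [set (W P X)%:E | P in Pset].

End defs.

(* Main.v *)
Require Import Defs.
From HB Require Import structures.
From mathcomp Require Import all_boot all_order all_algebra.
From mathcomp Require Import all_classical all_reals all_analysis.
From mathcomp Require Import measurable_realfun lra.
Import Order.TTheory GRing.Theory Num.Theory.
Import numFieldNormedType.Exports.
Local Open Scope classical_set_scope.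
Local Open Scope ring_scope.

(** Let [F] be the cdf of [lstar] under [Pstar] and [G] that of the optimal payoff
    [Xt].  The payoff [Xs = G^-1 (F lstar)] has the same [Pstar]-law as [Xt],
    because [F lstar] is uniform, and it is a nondecreasing function of the
    likelihood ratio [lstar].  Its upper level sets are therefore those of
    [lstar], so by the Neyman-Pearson lemma they have the least [Q]-mass among
    sets of the same [Pstar]-mass; integrating the tails, [Xs] is no more
    expensive than [Xt].  Monotonicity in [lstar] also transfers the first-order
    dominance of the laws of [lstar] to those of [Xs], so consistency gives
    [W Pstar Xs <= W P Xs] for all [P]: the infimum over the family is attained
    at [Pstar], with value [W Pstar Xt]. *)

(** * Measurable functions factor through the generator [S] *)

Lemma doob_dynkin {R : realType} {d : measure_display} {Om : measurableType d}
    (S X : Om -> R) :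
  generated_by S -> measurable_fun setT X ->
  exists2 g : R -> R, measurable_fun setT g & X = g \o S.
Proof.
move=> genS mX.
(* [c] enumerates the rationals; numbers that encode no rational give the harmless level 0. *)
pose c n : R := ratr (odflt 0 (unpickle n) : rat).
have /choice[B HB] n : exists B : set R,
    measurable B /\ [set w | X w <= c n] = S @^-1` B.
  apply/genS; rewrite -[X in measurable X]setTI.
  exact: measurable_fun_le.
(* At [s = S w], the infimum of [h n s] over [n] runs over the rationals at or above [X w], so by
   density it equals [X w]. *)
pose h n (s : R) : \bar R := if s \in B n then (c n)%:E else +oo%E.
have mh n : measurable_fun setT (h n).
  apply: measurable_fun_ifT => //.
  by apply: (measurable_fun_bool true); rewrite setTI preimage_mem_true; case: (HB n).
exists (fun s => fine (einfs (h ^~ s) 0)).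
  by apply: measurableT_comp => //; exact: measurable_fun_einfs.
apply/funext => w /=.
suff E : einfs (h ^~ (S w)) 0 = (X w)%:E by rewrite E.
rewrite /einfs /=.
have hE n : h n (S w) = if X w <= c n then (c n)%:E else +oo%E.
  rewrite /h; have [_ /seteqP[BS SB]] := HB n.
  case: ifPn => [/set_mem /SB /= ->//|]; case: ifPn => // /BS /= Bn.
  by move=> /negP[]; apply/mem_set.
apply/eqP; rewrite eq_le; apply/andP; split.
  apply/lee_addgt0Pr => e e0; rewrite -EFinD.
  have [q] := rat_in_itvoo (ltr_pwDr e0 (lexx (X w))).
  rewrite in_itv /= => /andP[Xq qe].
  apply: (@le_trans _ _ (ratr q)%:E); last by rewrite lee_fin ltW.
  apply: ereal_inf_lbound; exists (pickle q) => //=.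
  by rewrite hE /c pickleK /= ltW.
apply: le_ereal_inf_tmp => _ [n _ <-]; rewrite hE.
by case: ifPn => [//|_]; rewrite leey.
Qed.

(** * Distribution functions and the probability integral transform *)

Section cumulative.
Context {R : realType} {d : measure_display} {Om : measurableType d}.
Context (P : probability Om R) (X : Om -> R).
Hypothesis mX : measurable_fun setT X.

Let rX : {RV P >-> R} := HB.pack X (isMeasurableFun.Build _ _ _ _ _ mX).

Lemma measurable_sublevel x : measurable [set w | X w <= x].
Proof. by rewrite -[X in measurable X]setTI; exact: measurable_fun_le. Qed.

Lemma superlevel_setC x : [set w | x < X w] = ~` [set w | X w <= x].
Proof. by apply/seteqP; split => w /=; rewrite ltNge => /negP. Qed.

Lemma measurable_superlevel x : measurable [set w | x < X w].
Proof. by rewrite superlevel_setC; apply: measurableC; exact: measurable_sublevel. Qed.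

Definition rcdf x := fine (cdfP P X x).

Lemma rcdfE x : P [set w | X w <= x] = (rcdf x)%:E.
Proof. by rewrite /rcdf fineK// fin_num_measure//; exact: measurable_sublevel. Qed.

Let cdf_rcdf x : cdf rX x = (rcdf x)%:E.
Proof.
by rewrite -rcdfE.
Qed.

Lemma rcdf_ge0 x : 0 <= rcdf x.
Proof. by rewrite -lee_fin -rcdfE. Qed.

Lemma rcdf_le1 x : rcdf x <= 1.
Proof. by rewrite -lee_fin -rcdfE; apply: probability_le1; exact: measurable_sublevel. Qed.

Lemma rcdf_nondecreasing : {homo rcdf : x y / x <= y}.
Proof.
move=> x y xy; rewrite -lee_fin -!rcdfE; apply: le_measure.
- by rewrite inE; exact: measurable_sublevel.
- by rewrite inE; exact: measurable_sublevel.
- by move=> w /= /le_trans; apply.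
Qed.

Lemma measurable_rcdf_comp : measurable_fun setT (rcdf \o X).
Proof.
apply: measurableT_comp => //; apply: nondecreasing_measurable => //.
exact: rcdf_nondecreasing.
Qed.

Lemma superlevelE x : P [set w | x < X w] = (1 - rcdf x)%:E.
Proof. by rewrite superlevel_setC probability_setC ?rcdfE//; exact: measurable_sublevel. Qed.

(** Right continuity of the cdf, in the form that makes the infimum defining a quantile attained. *)
Lemma rcdf_right_closed (u x : R) :
  (forall e, 0 < e -> u <= rcdf (x + e)) -> u <= rcdf x.
Proof.
move=> ue; rewrite -lee_fin -cdf_rcdf.
have /(_ x) rc := @cdf_right_continuous _ _ _ P rX.
move: rc; apply: cvge_ge.
near=> y; rewrite cdf_rcdf lee_fin.
have := ue (y - x); rewrite [x + _]addrC subrK; apply; rewrite subr_gt0.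
by near: y; exact: nbhs_right_gt.
Unshelve. all: by end_near. Qed.

Lemma rcdf_ge_eventually (u : R) : u < 1 -> exists2 x, 0 <= x & u <= rcdf x.
Proof.
move=> u1.
have cy := @cvg_cdfy1 _ _ _ P rX.
have /cy : nbhs 1%E [set y : \bar R | (u%:E < y)%E] by exact: open_ereal_gt'.
case=> M [_ HM]; exists (Num.max 0 M + 1).
  by rewrite addr_ge0 // le_max lexx.
rewrite -lee_fin -cdf_rcdf; apply: ltW; apply: HM.
by rewrite ltr_pwDr // le_max lexx orbT.
Qed.

Hypothesis X0 : forall w, 0 <= X w.

Lemma rcdf_lt0 x : x < 0 -> rcdf x = 0.
Proof.
move=> x0; rewrite /rcdf /cdfP (_ : [set w | X w <= x] = set0) ?measure0//.
by apply/seteqP; split => // w /= /(le_trans (X0 w)); rewrite leNgt x0.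
Qed.

Hypothesis cX : continuous rcdf.

Lemma rcdf_surjective (u : R) : 0 <= u -> u < 1 -> exists c, rcdf c = u.
Proof.
move=> u0 u1; have [b b0 ub] := @rcdf_ge_eventually u u1.
(* Since [X] is nonnegative, its cdf vanishes at -1, which serves as the left endpoint. *)
have [|||c _ <-] := @IVT R rcdf (-1) b u; last by exists c.
- by apply: le_trans b0; rewrite lerN10.
- exact: continuous_subspaceT.
- rewrite rcdf_lt0 ?ltrN10// ge_min u0 /= le_max.
  by rewrite ub orbT.
Qed.

(** A point [c] with [rcdf c = u] gives the lower bound. As [rcdf] may stay flat to the right of
    [c], the upper bound compares with levels [v > u], for which [rcdf (X w) <= u] forces [X w]
    below a point of level [v], and lets [v] decrease to [u]. *)
Lemma probability_rcdf_le (u : R) : 0 <= u -> u < 1 ->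
  P [set w | rcdf (X w) <= u] = u%:E.
Proof.
move=> u0 u1.
have mF := measurable_rcdf_comp.
have mA : measurable [set w | rcdf (X w) <= u].
  by rewrite -[X in measurable X]setTI; exact: measurable_fun_le.
apply/eqP; rewrite eq_le; apply/andP; split; last first.
  have [c cu] := rcdf_surjective _ u0 u1.
  rewrite -cu -rcdfE; apply: le_measure; rewrite ?inE//; first exact: measurable_sublevel.
    by rewrite cu.
  by move=> w /= /rcdf_nondecreasing.
suff uv v : u < v -> v < 1 -> (P [set w | (rcdf (X w) <= u)%R] <= v%:E)%E.
  apply/lee_addgt0Pr => e e0; rewrite -EFinD.
  (* Half of this minimum, added to [u], stays below both [u + e] and 1, as surjectivity of the cdf
     requires. *)
  have h : 0 < Num.min e (1 - u) by rewrite lt_min e0 subr_gt0.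
  apply: (@le_trans _ _ (u + Num.min e (1 - u) / 2)%:E).
    apply: uv; first by rewrite ltrDl divr_gt0.
    have : Num.min e (1 - u) <= 1 - u by rewrite ge_min lexx orbT.
    by lra.
  rewrite lee_fin.
  have : Num.min e (1 - u) <= e by rewrite ge_min lexx.
  by lra.
move=> uv v1; have [c cv] := rcdf_surjective v (le_trans u0 (ltW uv)) v1.
rewrite -cv -rcdfE; apply: le_measure; rewrite ?inE//; first exact: measurable_sublevel.
move=> w /= wu; rewrite leNgt; apply/negP => /ltW /rcdf_nondecreasing.
by rewrite cv leNgt (le_lt_trans wu uv).
Qed.

Lemma probability_rcdf_ge1 : P [set w | 1 <= rcdf (X w)] = 0%E.
Proof.
have mF := measurable_rcdf_comp.
apply/eqP; rewrite eq_le measure_ge0 andbT; apply/lee_addgt0Pr => e e0; rewrite add0e.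
pose u := 1 - Num.min e 1.
have m0 : 0 < Num.min e 1 by rewrite lt_min e0 ltr01.
have m1 : Num.min e 1 <= 1 by rewrite ge_min lexx orbT.
have me : Num.min e 1 <= e by rewrite ge_min lexx.
have u0 : 0 <= u by rewrite /u; lra.
have u1 : u < 1 by rewrite /u; lra.
have mA : measurable [set w | rcdf (X w) <= u].
  by rewrite -[X in measurable X]setTI; exact: measurable_fun_le.
apply: (@le_trans _ _ (P (~` [set w | rcdf (X w) <= u]))).
  apply: le_measure; rewrite ?inE//.
  - by rewrite -[X in measurable X]setTI; exact: measurable_fun_le.
  - exact: measurableC.
  - by move=> w /= h; apply/negP; rewrite -ltNge (lt_le_trans u1 h).
rewrite probability_setC// probability_rcdf_le// lee_fin /u; lra.
Qed.

End cumulative.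

(** * Generalized inverses and the rearrangement along the likelihood ratio *)

Definition quantile {R : realType} (G : R -> R) (u : R) : R :=
  inf [set y | 0 <= y /\ u <= G y].

Lemma quantile_ge0 {R : realType} (G : R -> R) (u : R) : 0 <= quantile G u.
Proof.
rewrite /quantile; set A := [set y | _].
(* The infimum of the empty set is 0 by convention, so no bound on [u] is needed. *)
have [->|/set0P A0] := eqVneq A set0; first by rewrite inf0.
by apply: lb_le_inf => // y [].
Qed.

Section rearrangement.
Context {R : realType} {d : measure_display} {Om : measurableType d}.
Context (P : probability Om R) (l X : Om -> R).
Hypotheses (ml : measurable_fun setT l) (mX : measurable_fun setT X).

Local Notation F := (rcdf P l).
Local Notation G := (rcdf P X).

(** The Galois connection between a cdf and its inverse: [u < 1] makes the set under the infimum
    nonempty, and right continuity puts the infimum in it. *)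
Lemma quantile_le (u y : R) : u < 1 -> 0 <= y ->
  (quantile G u <= y) = (u <= G y).
Proof.
move=> u1 y0; apply/idP/idP => [qy|uG]; last first.
  by apply: ge_inf => //; exists 0 => z [].
apply: rcdf_right_closed => // e e0.
have [x x0 ux] := rcdf_ge_eventually P X mX u u1.
have hi : has_inf [set y | 0 <= y /\ u <= G y].
  by split; [exists x | exists 0 => z []].
have [z [z0 uz] zlt] := inf_adherent e0 hi.
apply: (le_trans uz); apply: rcdf_nondecreasing => //.
by apply: ltW; apply: (lt_le_trans zlt); rewrite lerD2r.
Qed.

(* The value 0 on [F x >= 1] is a junk value on a null set: there the quantile of
   an unbounded [X] would be infinite. *)
Definition rearr (x : R) : R := if F x < 1 then quantile G (F x) else 0.

Lemma rearr_ge0 x : 0 <= rearr x.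
Proof. by rewrite /rearr; case: ifP => // _; exact: quantile_ge0. Qed.

Lemma rearr_le x y : F x < 1 -> 0 <= y -> (rearr x <= y) = (F x <= G y).
Proof. by move=> Fx y0; rewrite /rearr Fx quantile_le. Qed.

(** The bound [F y < 1] keeps away from the junk value 0, which can break monotonicity. *)
Lemma rearr_nondecreasing x y : x <= y -> F y < 1 -> rearr x <= rearr y.
Proof.
move=> xy Fy; have Fxy : F x <= F y by exact: rcdf_nondecreasing.
rewrite rearr_le ?rearr_ge0 ?(le_lt_trans Fxy)//.
by apply: (le_trans Fxy); rewrite -rearr_le ?rearr_ge0.
Qed.

Lemma measurable_rearr : measurable_fun setT rearr.
Proof.
pose q u := if u < 1 then quantile G u else 0.
suff mq : measurable_fun setT q.
  rewrite (_ : rearr = q \o F)//; apply: measurableT_comp => //.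
  by apply: nondecreasing_measurable => //; exact: rcdf_nondecreasing.
apply: (measurability (@RGenOInfty.G R)) => [|/= _ [_] [r] -> <-].
  exact: RGenOInfty.measurableE.
rewrite setTI.
have [r0|r0] := ltP r 0.
  rewrite (_ : _ @^-1` _ = setT)//; apply/seteqP; split => // u _ /=.
  rewrite in_itv /= andbT (lt_le_trans r0)// /q; case: ifP => // _.
  exact: quantile_ge0.
rewrite (_ : _ @^-1` _ = `]G r, 1[%classic)//; apply/seteqP; split => u /=.
  rewrite !in_itv /= andbT /q; case: ifPn => [u1|_]; last by rewrite ltNge r0.
  by rewrite !ltNge quantile_le// => ->.
rewrite !in_itv /= andbT /q => /andP[Gu u1]; rewrite u1.
by rewrite ltNge quantile_le// -ltNge.
Qed.

Lemma measurable_rearr_comp : measurable_fun setT (rearr \o l).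
Proof. by apply: measurableT_comp => //; exact: measurable_rearr. Qed.

Hypotheses (l0 : forall w, 0 <= l w) (X0 : forall w, 0 <= X w).
Hypothesis cF : continuous F.

(** The Galois connection turns the sublevel set at [y >= 0] into that of [F l] at [G y], up to the
    null set where [F l] reaches 1; uniformity of [F l] gives its mass. *)
Lemma cdf_rearr y : cdfP P (rearr \o l) y = cdfP P X y.
Proof.
have [y0|y0] := ltP y 0.
  rewrite /cdfP; congr (P _); apply/seteqP; split => w /= h; exfalso.
  - by move: (le_lt_trans h y0); rewrite ltNge rearr_ge0.
  - by move: (le_lt_trans h y0); rewrite ltNge X0.
have m1 := measurable_sublevel _ (measurable_rcdf_comp P l ml) (G y).
(* Uniformity is available only below level 1; when [G y = 1] the sublevel set is the whole
   space. *)
have [G1|G1] := ltP (G y) 1; last first.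
  have GE : G y = 1 by apply/eqP; rewrite eq_le G1 rcdf_le1.
  rewrite [RHS]rcdfE// GE -(@probability_setT _ _ _ P) /cdfP; congr (P _).
  apply/seteqP; split => // w _ /=; have [Fw|Fw] := ltP (F (l w)) 1.
    by rewrite rearr_le// GE ltW.
  by rewrite /rearr ltNge Fw.
rewrite [RHS]rcdfE// -(probability_rcdf_le P l ml l0 cF (G y))//; last exact: rcdf_ge0.
rewrite /cdfP (_ : [set w | _] =
    [set w | F (l w) <= G y] `|` [set w | 1 <= F (l w)]).
  rewrite measureU0//; last exact: probability_rcdf_ge1.
  by rewrite -[X in measurable X]setTI; apply: measurable_fun_le => //; exact: measurable_rcdf_comp.
apply/seteqP; split => w /=; have [Fw|Fw] := ltP (F (l w)) 1.
- by rewrite rearr_le//; left.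
- by right.
- by rewrite rearr_le// => -[//|]; rewrite leNgt.
- by rewrite /rearr ltNge Fw.
Qed.

End rearrangement.

(** * The Neyman-Pearson inequality and comparison of expectations through tails *)

Lemma neyman_pearson {R : realType} {d : measure_display} {Om : measurableType d}
    (P Q : probability Om R) (l : Om -> R) (c : R) (B : set Om) :
  is_RN_density P Q l -> 0 < c -> measurable B ->
  (P [set w | (c < l w)%R] <= P B)%E -> (Q [set w | (c < l w)%R] <= Q B)%E.
Proof.
move=> [ml l0 lP] c0 mB; set A := [set w | _] => PAB.
have mA : measurable A by exact: measurable_superlevel.
have mAB : measurable (A `\` B) by exact: measurableD.
have mBA : measurable (B `\` A) by exact: measurableD.
have mlD D : measurable_fun D (fun w => (l w)%:E).
  by apply/measurable_EFinP; exact: measurable_funTS.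
(* The density exceeds [c] on [A] minus [B] and is at most [c] on [B] minus [A]. After the common
   part is cancelled, the order of the [P]-masses passes to the [Q]-masses on division by [c]. *)
have lo : (c%:E * Q (A `\` B) <= P (A `\` B))%E.
  rewrite lP// -integral_cst//; apply: ge0_le_integral => //.
  - by move=> w _; rewrite lee_fin ltW.
  - by move=> w [/= cw _]; rewrite lee_fin ltW.
have hi : (P (B `\` A) <= c%:E * Q (B `\` A))%E.
  rewrite lP// -integral_cst//; apply: ge0_le_integral => //.
  - by move=> w _; rewrite lee_fin.
  - by move=> w [_ /= /negP]; rewrite -leNgt lee_fin.
have split_meas (mu : probability Om R) : mu A = (mu (A `\` B) + mu (A `&` B))%E /\
    mu B = (mu (B `\` A) + mu (A `&` B))%E.
  split; first by rewrite -measureDI.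
  by rewrite setIC -measureDI.
have [PA PB] := split_meas P; have [QA QB] := split_meas Q.
move: PAB lo hi; rewrite PA PB QA QB.
have fin (mu : probability Om R) D : measurable D -> mu D = (fine (mu D))%:E.
  by move=> mD; rewrite fineK// fin_num_measure.
have mI : measurable (A `&` B) by exact: measurableI.
rewrite (fin P _ mAB) (fin P _ mBA) (fin P _ mI).
rewrite (fin Q _ mAB) (fin Q _ mBA) (fin Q _ mI).
rewrite -!EFinD -!EFinM !lee_fin !lerD2r => h1 h2 h3.
by rewrite -(ler_pM2l c0) (le_trans h2)// (le_trans h1).
Qed.

(** Layer-cake formula: a nonnegative variable has as expectation the integral of its tail over the
    half-line. *)
Lemma ge0_le_integral_tail {R : realType} {d : measure_display}
    {Om : measurableType d} (Q : probability Om R) (X Y : Om -> R) :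
  measurable_fun setT X -> measurable_fun setT Y ->
  (forall w, 0 <= X w) -> (forall w, 0 <= Y w) ->
  (forall t, 0 <= t -> (Q [set w | (t < X w)%R] <= Q [set w | (t < Y w)%R])%E) ->
  (\int[Q]_w (X w)%:E <= \int[Q]_w (Y w)%:E)%E.
Proof.
move=> mX mY X0 Y0 XY.
pose rX : {RV Q >-> R} := HB.pack X (isMeasurableFun.Build _ _ _ _ _ mX).
pose rY : {RV Q >-> R} := HB.pack Y (isMeasurableFun.Build _ _ _ _ _ mY).
have := @ge0_expectation_ccdf _ _ _ Q rX X0.
have := @ge0_expectation_ccdf _ _ _ Q rY Y0.
rewrite !unlock => -> ->; apply: ge0_le_integral => //.
- by apply: measurable_funTS; exact: (@ccdf_measurable _ _ _ Q rX).
- by apply: measurable_funTS; exact: (@ccdf_measurable _ _ _ Q rY).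
move=> t /=; rewrite in_itv /= andbT => t0.
have tail (Z : Om -> R) : Z @^-1` `]t, +oo[%classic = [set w | t < Z w].
  by apply/seteqP; split => w /=; rewrite in_itv /= andbT.
by rewrite /ccdf /distribution /pushforward !tail; exact: XY.
Qed.

(** * Cost of the rearranged payoff *)

Section cheaper.
Context {R : realType} {d : measure_display} {Om : measurableType d}.
Context (P Q : probability Om R) (l X : Om -> R).
Hypotheses (lPQ : is_RN_density P Q l) (PQ : equiv_meas P Q).
Hypotheses (mX : measurable_fun setT X) (X0 : forall w, 0 <= X w).
Local Notation F := (rcdf P l).
Local Notation G := (rcdf P X).
Local Notation phi := (rearr P l X).
Hypothesis cF : continuous F.

(** The density is zero wherever it is at most 0, so that set has no [P]-mass. This makes the
    Neyman-Pearson threshold positive. *)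
Lemma rcdf_density0 : F 0 = 0.
Proof.
have [ml l0 lP] := lPQ.
rewrite /rcdf /cdfP lP; last exact: measurable_sublevel.
rewrite integral0_eq// => w /= lw.
by congr (_%:E); apply/eqP; rewrite eq_le lw l0.
Qed.

(** If [0 < G t < 1], choose [c] with [F c = G t]: the tail of the rearrangement lies in the set
    where [l > c], which has the same [P]-mass as the tail of [X], so Neyman-Pearson applies. *)
Lemma rearr_tail_le t : 0 <= t ->
  (Q [set w | (t < phi (l w))%R] <= Q [set w | (t < X w)%R])%E.
Proof.
have [ml l0 lP] := lPQ; move=> t0.
have mphi := measurable_superlevel _ (measurable_rearr_comp P l X ml mX) t.
have G01 := rcdf_ge0 P X mX t.
(* When [G t = 1], the rearrangement never exceeds [t]. *)
have [G1|G1] := ltP (G t) 1; last first.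
  rewrite (_ : [set w | (t < phi (l w))%R] = set0) ?measure0 ?measure_ge0//.
  apply/seteqP; split => // w /=; have [Fw|Fw] := ltP (F (l w)) 1.
    by rewrite ltNge rearr_le// (le_trans (ltW Fw) G1).
  by rewrite /rearr (ltNge (F _)) Fw/= ltNge t0.
(* Here a positive threshold is not guaranteed, but [Q] inherits the null set [X <= t] from [P], so
   the right-hand side is 1. *)
have [G0|G0] := eqVneq (G t) 0.
  have mt := measurable_sublevel X mX t.
  have Qt : Q [set w | (X w <= t)%R] = 0%E.
    have Pt : P [set w | (X w <= t)%R] = 0%E by rewrite rcdfE// G0.
    by case: PQ => _ /null_content_dominatesP; apply.
  rewrite [leRHS]superlevelE// /rcdf /cdfP Qt /= subr0.
  exact: probability_le1.
have [c cG] := rcdf_surjective P l ml l0 cF (G t) G01 G1.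
have c0 : 0 < c.
  rewrite ltNge; apply/negP => /(rcdf_nondecreasing P l ml).
  rewrite rcdf_density0 cG => G0'; case/negP: G0.
  by rewrite eq_le G0' G01.
apply: (@le_trans _ _ (Q [set w | (c < l w)%R])).
  apply: le_measure; rewrite ?inE//; first exact: measurable_superlevel.
  move=> w /= tw; rewrite ltNge; apply/negP => /(rcdf_nondecreasing P l ml).
  rewrite cG => FG; move: tw; rewrite ltNge => /negP; apply.
  by rewrite rearr_le// (le_lt_trans FG G1).
apply: (neyman_pearson P) => //; first exact: measurable_superlevel.
by rewrite !superlevelE// cG.
Qed.

Lemma rearr_cheaper : (\int[Q]_w (phi (l w))%:E <= \int[Q]_w (X w)%:E)%E.
Proof.
have [ml l0 lP] := lPQ.
apply: ge0_le_integral_tail => //.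
- exact: measurable_rearr_comp.
- by move=> w; exact: rearr_ge0.
- exact: rearr_tail_le.
Qed.

End cheaper.

(** * First-order dominance expressed on the sample space *)

Section fsd.
Context {R : realType} {d : measure_display} {Om : measurableType d}.
Local Notation Rp := [set x : R | 0 <= x].

Lemma measurable_nonneg : measurable Rp.
Proof.
rewrite (_ : Rp = `[0, +oo[%classic)//.
by apply/seteqP; split => x /=; rewrite in_itv /= andbT.
Qed.

Lemma law_integrable (P : probability Om R) (X : Om -> R) (f : R -> R) :
  measurable_fun setT X -> (forall w, 0 <= X w) -> measurable_fun setT f ->
  (law P X).-integrable Rp (EFin \o f) <-> P.-integrable setT (EFin \o (f \o X)).
Proof.
move=> mX X0 mf.
have XE : X @^-1` Rp = setT by apply/seteqP; split => // w _ /=.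
have mRp := measurable_nonneg.
have mEf : measurable_fun setT (EFin \o f) by exact/measurable_EFinP.
split=> [/integrableP[_ fi]|fi]; last first.
  by apply: integrable_pushforward => //; rewrite XE.
apply/integrableP; split.
  by apply/measurable_EFinP; exact: measurableT_comp.
move: fi; rewrite ge0_integral_pushforward ?XE//.
by apply: measurableT_comp => //; exact: measurable_funTS.
Qed.

Lemma law_integral (P : probability Om R) (X : Om -> R) (f : R -> R) :
  measurable_fun setT X -> (forall w, 0 <= X w) -> measurable_fun setT f ->
  P.-integrable setT (EFin \o (f \o X)) ->
  (\int[law P X]_(x in Rp) (f x)%:E = \int[P]_w (f (X w))%:E)%E.
Proof.
move=> mX X0 mf fi.
have XE : X @^-1` Rp = setT by apply/seteqP; split => // w _ /=.
have mEf : measurable_fun setT (EFin \o f) by exact/measurable_EFinP.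
have := @integral_pushforward _ _ _ _ R X mX P Rp (EFin \o f) mEf.
by rewrite XE => /(_ fi measurable_nonneg).
Qed.

Lemma fsd_le_lawP (P P' : probability Om R) (X : Om -> R) :
  measurable_fun setT X -> (forall w, 0 <= X w) ->
  fsd_le (law P X) (law P' X) <->
  (forall f : R -> R, {homo f : x y / x <= y} ->
    P.-integrable setT (EFin \o (f \o X)) -> P'.-integrable setT (EFin \o (f \o X)) ->
    (\int[P]_w (f (X w))%:E <= \int[P']_w (f (X w))%:E)%E).
Proof.
move=> mX X0; split=> [fsd f nf fP fP'|H f nf fP fP'].
  have mf : measurable_fun setT f by exact: nondecreasing_measurable.
  rewrite -!law_integral//; apply: fsd => //.
  - by move=> x y _; exact: nf.
  - exact/law_integrable.
  - exact/law_integrable.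
(* A test function for [fsd_le] is monotone only on the half-line; freezing it at [f 0] on the left
   makes it monotone, hence measurable, on the whole line. *)
pose g x := f (Num.max 0 x).
have ng : {homo g : x y / x <= y}.
  move=> x y xy; apply: nf; first by rewrite le_max lexx.
  by rewrite ge_max !le_max lexx xy orbT.
have mg : measurable_fun setT g by exact: nondecreasing_measurable.
have fg x : x \in Rp -> f x = g x.
  by move=> /set_mem /= x0; rewrite /g max_r.
have gi (mu : probability Om R) : (law mu X).-integrable Rp (EFin \o f) ->
    mu.-integrable setT (EFin \o (g \o X)).
  move=> /integrableP[_ fi]; apply/law_integrable => //; apply/integrableP; split.
    by apply: measurable_funTS; exact/measurable_EFinP.
  move: fi; rewrite (eq_integral (fun x => `|(g x)%:E|)%E)//.
  by move=> x /fg /= ->.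
have fgint (mu : probability Om R) : (law mu X).-integrable Rp (EFin \o f) ->
    (\int[law mu X]_(x in Rp) (f x)%:E = \int[mu]_w (g (X w))%:E)%E.
  move=> fi; rewrite (eq_integral (fun x => (g x)%:E)); last by move=> x /fg ->.
  by apply: law_integral => //; exact: gi.
by rewrite !fgint//; apply: H => //; exact: gi.
Qed.

End fsd.

(** * Transfer of dominance from the likelihood ratio to the rearrangement *)

Section fsd_rearrangement.
Context {R : realType} {d : measure_display} {Om : measurableType d}.
Context (P : probability Om R) (l X : Om -> R).
Hypotheses (ml : measurable_fun setT l) (mX : measurable_fun setT X).
Hypotheses (l0 : forall w, 0 <= l w).
Local Notation F := (rcdf P l).
Local Notation phi := (rearr P l X).
Hypothesis cF : continuous F.

(* [f \o phi] itself need not extend to a real-valued monotone function beyond the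
   essential supremum of [l], hence the truncation. *)
Let trunc (f : R -> R) (n : nat) (x : R) : R :=
  if F x < 1 then Num.min (f (phi x)) n%:R else n%:R.

Let trunc_nondecreasing f n : {homo f : x y / x <= y} ->
  {homo trunc f n : x y / x <= y}.
Proof.
move=> nf x y xy; rewrite /trunc.
have Fxy := rcdf_nondecreasing P l ml _ _ xy.
have [Fy|Fy] := ltP (F y) 1.
  rewrite (le_lt_trans Fxy Fy) le_min !ge_min lexx orbT andbT.
  by rewrite nf//; apply: rearr_nondecreasing.
by case: ifP => // _; rewrite ge_min lexx orbT.
Qed.

Let trunc_integrable (mu : probability Om R) f n : {homo f : x y / x <= y} ->
  mu.-integrable setT (EFin \o (f \o (phi \o l))) ->
  mu.-integrable setT (EFin \o (trunc f n \o l)).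
Proof.
move=> nf fi.
have mt : measurable_fun setT (trunc f n \o l).
  apply: measurableT_comp => //; apply: nondecreasing_measurable => //.
  exact: trunc_nondecreasing.
have ni : mu.-integrable setT (EFin \o cst n%:R).
  exact: finite_measure_integrable_cst.
(* The truncation caps [f] only from above, so the bound is the absolute value of [f] at the
   rearrangement plus [n]. *)
have gi := integrableD measurableT (integrable_abse fi) ni.
apply: le_integrable gi => //; first exact/measurable_EFinP.
move=> w _ /=; rewrite lee_fin [leRHS]ger0_norm; last by rewrite addr_ge0.
rewrite /trunc; case: ifP => _; last by rewrite ger0_norm// lerDr.
have [_|h] := leP (f (phi (l w))) n%:R; first by rewrite lerDl.
by rewrite ger0_norm// lerDr.
Qed.

Let trunc_cvg (mu : probability Om R) f : mu [set w | 1 <= F (l w)] = 0%E ->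
  {homo f : x y / x <= y} ->
  mu.-integrable setT (EFin \o (f \o (phi \o l))) ->
  (\int[mu]_w (trunc f n (l w))%:E)%E @[n --> \oo] -->
    (\int[mu]_w (f (phi (l w)))%:E)%E.
Proof.
move=> mu0 nf fi.
have mN : measurable [set w | 1 <= F (l w)].
  rewrite -[X in measurable X]setTI; apply: measurable_fun_le => //.
  exact: measurable_rcdf_comp.
(* Off the null set, the truncations are eventually constant in [n]; since [n] is nonnegative,
   capping at [n] never increases the absolute value. *)
have [] // := @dominated_convergence _ _ R mu setT measurableT
  (fun n => EFin \o (trunc f n \o l)) (EFin \o (f \o (phi \o l)))
  (abse \o (EFin \o (f \o (phi \o l)))).
- by move=> n; exact: measurable_int (trunc_integrable mu f n nf fi).
- exact: measurable_int fi.
- exists [set w | 1 <= F (l w)]; split => // w /= h; rewrite leNgt; apply/negP => Fw.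
  apply: h => _; apply: cvg_near_cst.
  near=> n; rewrite /trunc Fw min_l//.
  by near: n; exact: nbhs_infty_ger.
- exact: integrable_abse.
- exists [set w | 1 <= F (l w)]; split => // w /= h; rewrite leNgt; apply/negP => Fw.
  apply: h => n _; rewrite /trunc Fw lee_fin.
  have [//|h] := leP (f (phi (l w))) n%:R.
  by rewrite !ger0_norm ?(ltW h)// (le_trans _ (ltW h)).
Unshelve. all: by end_near. Qed.

(** Each truncation is a nondecreasing function of [l], so the assumed dominance applies to it;
    absolute continuity makes the exceptional set null under [P'] too, and both sides pass to the
    limit. *)
Lemma fsd_le_rearr (P' : probability Om R) : P' `<< P ->
  fsd_le (law P l) (law P' l) ->
  fsd_le (law P (phi \o l)) (law P' (phi \o l)).
Proof.
move=> P'P /(fsd_le_lawP P P' l ml l0) fsd.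
apply/fsd_le_lawP.
- exact: measurable_rearr_comp.
- by move=> w; exact: rearr_ge0.
move=> f nf fP fP'.
have N0 := probability_rcdf_ge1 P l ml l0 cF.
have N0' : P' [set w | 1 <= F (l w)] = 0%E.
  move/null_content_dominatesP : P'P; apply => //.
  rewrite -[X in measurable X]setTI; apply: measurable_fun_le => //.
  exact: measurable_rcdf_comp.
have c := trunc_cvg P f N0 nf fP; have c' := trunc_cvg P' f N0' nf fP'.
apply: (lee_cvg_to c c').
apply: nearW => n; apply: fsd.
- exact: trunc_nondecreasing.
- exact: trunc_integrable.
- exact: trunc_integrable.
Qed.

End fsd_rearrangement.

(** * Solution of the robust problem *)

Theorem mainTheorem8 (R : realType) (d : measure_display) (Om : measurableType d)
  (r Tm x0 : R) (S : Om -> R)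
  (Pset : set (probability Om R)) (Q : probability Om R)
  (W : probability Om R -> (Om -> R) -> R)
  (Pstar : probability Om R) (lstar : Om -> R) (Xt : Om -> R) :
  0 < Tm ->
  (forall w, 0 <= S w) -> measurable_fun setT S -> generated_by S ->
  (forall P P', Pset P -> Pset P' -> equiv_meas P P') ->
  (forall P, Pset P -> equiv_meas P Q) ->
  0 < x0 ->
  least_favorable Pset Q Pstar lstar ->
  condC4 Pstar lstar ->
  law_invariant_family Pset Q S W ->
  fsd_family_consistent Pset W (Yfam Pset Q S r Tm x0 W) Pstar ->
  Yfam Pset Q S r Tm x0 W Xt ->
  (forall X, Ysingle Q S r Tm x0 (W Pstar) X -> W Pstar X <= W Pstar Xt) ->
  exists Xs, [/\ Yfam Pset Q S r Tm x0 W Xs,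
    (forall X, Yfam Pset Q S r Tm x0 W X ->
       (robust_value Pset W X <= robust_value Pset W Xs)%E) &
    robust_value Pset W Xs = (W Pstar Xt)%:E].
Proof.
move=> _ S0 mS genS equivP equivQ _ [PsP dens fsd] [cF _] lawinv cons YXt Xtmax.
have [ml l0 _] := dens.
have [payXt priceXt] := YXt _ PsP.
have [[g [_ g0 Xtg]] Xtint] := payXt.
have mXt : measurable_fun setT Xt by exact/measurable_EFinP/(measurable_int _ Xtint).
have Xt0 w : 0 <= Xt w by rewrite Xtg /=; exact: g0.
pose Xs := rearr Pstar lstar Xt \o lstar.
have mXs : measurable_fun setT Xs by exact: measurable_rearr_comp.
have Xs0 w : 0 <= Xs w by exact: rearr_ge0.
have cheap : (\int[Q]_w (Xs w)%:E <= \int[Q]_w (Xt w)%:E)%E.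
  by apply: rearr_cheaper => //; exact: equivQ.
have payXs : payoff Q S Xs.
  split.
    have [h mh hS] := doob_dynkin S Xs genS mXs.
    (* The factor [h] is known to be nonnegative only on the range of [S]; the maximum with 0
       changes nothing there. *)
    exists (fun x => Num.max 0 (h x)); split.
    - by apply: measurable_funTS; exact: measurable_maxr.
    - by move=> x _; rewrite le_max lexx.
    - by apply/funext => w /=; rewrite max_r -[h (S w)]/((h \o S) w) -hS.
  apply/integrableP; split; first exact/measurable_EFinP.
  rewrite (eq_integral (fun w => (Xs w)%:E)); last first.
    by move=> w _; rewrite /= ger0_norm.
  apply: (le_lt_trans cheap).
  by have /integrable_lty := Xtint; apply.
have YXs : Yfam Pset Q S r Tm x0 W Xs.
  (* Payoff and budget conditions involve only [Q], so the same check serves every [P]. *)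
  move=> P _; split=> //; apply: le_trans priceXt.
  by apply: lee_wpmul2l => //; rewrite lee_fin expR_ge0.
have WXs : W Pstar Xs = W Pstar Xt.
  by apply: lawinv => // x; exact: cdf_rearr.
have robXs : robust_value Pset W Xs = (W Pstar Xt)%:E.
  apply/eqP; rewrite eq_le -WXs; apply/andP; split.
    by apply: ereal_inf_lbound; exists Pstar.
  apply: le_ereal_inf_tmp => _ [P PP <-]; rewrite lee_fin.
  apply: cons => // P' P'P; apply: fsd_le_rearr => //; last exact: fsd.
  by have [] := equivP _ _ P'P PsP.
exists Xs; split => // X YX; rewrite robXs.
(* For any competitor the infimum is at most the value at [Pstar], where [Xt] is optimal. *)
apply: (@le_trans _ _ (W Pstar X)%:E).
  by apply: ereal_inf_lbound; exists Pstar.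
by rewrite lee_fin; apply: Xtmax; exact: YX.
Qed.
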